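(* Let $G$ be an infinite commutative group and let $f:G\to\mathbb{R}$ be a bounded function with $f\ge0$. Then $$M^*(f)=E(f)=\inf_{B}\ \sup_{t\in G}\,(f|B)(t),$$ where $B$ runs over all finite nonempty subsets of $G$.
   Context: $G$ is an infinite commutative (discrete) group, written additively. For a bounded function $f:G\to\mathbb{R}$, the uppermost mean is $$M^*(f)=\inf_g\sup_{x\in G} g(x),$$ where $g$ runs over all convex combinations of translates of $f$, i.e. all functions $g(x)=\sum_{i=1}^n c_i f(x+t_i)$ with $n\ge1$, $t_i\in G$, $c_i\ge0$, $\sum c_i=1$. For a finite nonempty $B\subset G$, the $B$-average of $f$ is $(f|B)(t)=\frac1{|B|}\sum_{b\in B}f(b+t)$. The expansion pseudomean of $f$ is $$E(f)=\inf_{T}\ \sup_{B}\ \frac1{|B+T|}\sum_{b\in B}f(b),$$ where $T$ and $B$ run over the finite nonempty subsets of $G$, and $B+T=\{b+t:b\in B,t\in T\}$. *)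

(* Defs.v *)
From HB Require Import structures.
From mathcomp Require Import all_boot all_order all_algebra finmap.
From mathcomp Require Import all_classical all_reals all_analysis.

Set Implicit Arguments.
Unset Strict Implicit.
Unset Printing Implicit Defensive.

Import Order.TTheory GRing.Theory Num.Theory.
Import numFieldNormedType.Exports.
Local Open Scope classical_set_scope.
Local Open Scope ring_scope.

(* [sup] and [inf] on [set R] have the junk value [0] on sets that are empty
   or unbounded on the relevant side.  This never matters below: for bounded
   [f] every set involved is nonempty and bounded. *)

Definition translates_convex_comb (R : realType) (G : zmodType)
    (f g : G -> R) : Prop :=
  exists (n : nat) (c : 'I_n -> R) (t : 'I_n -> G),
    [/\ (0 < n)%N, forall i, 0 <= c i, \sum_(i < n) c i = 1 &
        forall x, g x = \sum_(i < n) c i * f (x + t i)].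

Definition uppermost_mean (R : realType) (G : zmodType) (f : G -> R) : R :=
  inf [set sup (range g) | g in [set g | translates_convex_comb f g]].

Definition fset_average (R : realType) (G : zmodType) (f : G -> R)
    (B : {fset G}) (t : G) : R :=
  (#|` B|%:R)^-1 * \sum_(b <- B) f (b + t).

Definition fset_sumset (G : zmodType) (B T : {fset G}) : {fset G} :=
  [fset (b + t)%R | b in B, t in T]%fset.

Definition expansion_pseudomean (R : realType) (G : zmodType)
    (f : G -> R) : R :=
  inf [set sup [set (#|` fset_sumset B T|%:R)^-1 * \sum_(b <- B) f b
               | B in [set B : {fset G} | B != fset0]]
      | T in [set T : {fset G} | T != fset0]].

(* Main.v *)
(* Write A for the right-hand infimum over averages; then E <= M* <= A <= E.
   The middle inequality holds because averages are convex combinations of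
   translates.  For the first, if a convex combination g of the translates by
   t_i satisfies g <= s, summing g over B - {t_i} bounds the sum of f over B by
   s |B - {t_i}|, as f >= 0.  For the last, given T, average f over a finite F
   that T hardly enlarges, |F + T| <= (1 + e)|F|; such F exist because the boxes
   generated by T grow only polynomially. *)
Require Import Defs.
From HB Require Import structures.
From mathcomp Require Import all_boot all_order all_algebra finmap.
From mathcomp Require Import all_classical all_reals all_analysis.
From mathcomp Require Import zify lra.

Set Implicit Arguments.
Unset Strict Implicit.
Unset Printing Implicit Defensive.

Import Order.TTheory GRing.Theory Num.Theory.
Import numFieldNormedType.Exports.
Local Open Scope classical_set_scope.
Local Open Scope ring_scope.

(** Common form of the three inequalities between infima. The slack [e] matters only for A <= E,
    where Følner sets are only approximately invariant. *)
Lemma inf_le_approx (R : realType) (X Y : set R) :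
  has_lbound X -> Y !=set0 ->
  (forall y, Y y -> forall e, 0 < e -> exists2 x, X x & x <= y + e) ->
  inf X <= inf Y.
Proof.
move=> Xlb Y0 XY; apply: lb_le_inf => // y Yy.
apply/ler_addgt0Pr => e e0; have [x Xx xy] := XY _ Yy _ e0.
exact: le_trans (ge_inf Xlb Xx) xy.
Qed.

(** * Growth estimates and the existence of Følner sets *)

Lemma bernoulli_ge (R : realDomainType) (x : R) (n : nat) :
  0 <= x -> 1 + n%:R * x <= (1 + x) ^+ n.
Proof.
move=> x0; elim: n => [|n IHn]; first by rewrite mul0r addr0 expr0.
rewrite exprS -natr1; apply: le_trans (ler_wpM2l _ IHn); last by lra.
have: 0 <= n%:R * x * x by rewrite !mulr_ge0 ?ler0n.
lra.
Qed.

Lemma expr_dominates_poly (R : archiRealFieldType) (d : nat) (e : R) :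
  0 < e -> exists N : nat, N.+1%:R ^+ d < (1 + e) ^+ N.
Proof.
(* With [e <= 1], Bernoulli's 1 + K e is at least e (K + 1), the base needed below. *)
wlog e1 : e / e <= 1 => [wlog_e e0|e0].
  have [/wlog_e/(_ e0)//|/ltW le1e] := leP e 1.
  have [N lN] := wlog_e 1 (lexx _) ltr01; exists N.
  by apply: (lt_le_trans lN); rewrite lerXn2r ?nnegrE; lra.
(* [C < K + 1] is exactly what remains of ((d+1)(K+1))^d < (e(K+1))^(d+1) after cancelling
   (K+1)^d. *)
set C : R := d.+1%:R ^+ d / e ^+ d.+1.
have eX0 : 0 < e ^+ d.+1 by rewrite exprn_gt0.
pose K := Num.truncn C; have CK : C < K.+1%:R by exact: truncnS_gt.
exists (K * d.+1)%N.
have K0 : (0 : R) < K.+1%:R by rewrite ltr0n.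
(* With N = K (d+1) both sides become powers in which the base grows linearly
   in K, but with exponents d and d+1 respectively. *)
apply: (@le_lt_trans _ _ ((d.+1 * K.+1)%:R ^+ d)).
  have KN : ((K * d.+1).+1 <= d.+1 * K.+1)%N by lia.
  by rewrite lerXn2r ?nnegrE ?ler0n ?ler_nat.
apply: (@lt_le_trans _ _ ((e * K.+1%:R) ^+ d.+1)).
  rewrite natrM !exprMn [K.+1%:R ^+ d.+1]exprS mulrA ltr_pM2r ?exprn_gt0//.
  by move: CK; rewrite /C ltr_pdivrMr// mulrC.
rewrite exprM lerXn2r ?nnegrE ?mulr_ge0 ?exprn_ge0 ?addr_ge0 ?ler0n ?(ltW e0)//.
apply: le_trans (bernoulli_ge K (ltW e0)).
rewrite -natr1; lra.
Qed.

(* The boxes {sum_(t in T) k_t t | 0 <= k_t <= N} have at most (N+1)^|T|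
   elements, so their cardinals cannot grow by a factor 1+e at every step. *)
Lemma exists_folner_set (R : archiRealFieldType) (G : zmodType)
    (T : {fset G}) (e : R) : 0 < e ->
  exists2 F : {fset G}, F != fset0 &
    #|` fset_sumset F T|%:R <= (1 + e) * #|` F|%:R.
Proof.
move=> e0; apply: contrapT => noF.
have {}noF F : F != fset0 -> (1 + e) * #|` F|%:R < #|` fset_sumset F T|%:R.
  by move=> F0; rewrite ltNge; apply/negP => lF; apply: noF; exists F.
pose comb N (k : {ffun T -> 'I_N.+1}) : G := \sum_(t : T) val t *+ k t.
pose box N : {fset G} :=
  [fset comb N k | k in [set: {ffun T -> 'I_N.+1}]%SET]%fset.
have box0 N : box N != fset0.
  apply/fset0Pn; exists (comb N [ffun=> ord0]).
  by apply: in_imfset; rewrite inE.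
have box_card N : (#|` box N| <= N.+1 ^ #|` T|)%N.
  apply: (leq_trans (leq_imfset_card _ _ _)).
  have -> : (N.+1 ^ #|` T| = #|[set: {ffun T -> 'I_N.+1}]%SET|)%N.
    by rewrite cardsT card_ffun card_ord cardfE.
  by rewrite cardE uniq_leq_size ?enum_finmem_uniq.
have box_step N : (fset_sumset (box N) T `<=` box N.+1)%fset.
  apply/fsubsetP => x /imfset2P[y /imfsetP[k _ ->]] [t tT ->].
  apply/imfsetP => /=.
  (* Adding t raises only the coefficient of t, by one. The new coefficients are at most N + 1, so
     [inord] never falls back on its default. *)
  exists [ffun s => inord (k s + (val s == t))%N]; first by rewrite inE.
  rewrite /comb (bigD1 [` tT]%fset)//= [RHS](bigD1 [` tT]%fset)//=.
  rewrite ffunE /= eqxx inordK; last by rewrite addn1 ltnS ltn_ord.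
  rewrite addn1 mulrSr addrAC; congr (_ + _ + _).
  apply: eq_bigr => s sNt; rewrite ffunE.
  rewrite (_ : (val s == t) = false) ?addn0 ?inordK//.
    by rewrite (ltn_trans (ltn_ord (k s))).
  by apply: contraNF sNt => /eqP st; apply/eqP/val_inj.
(* Iterating the assumed failure of near-invariance forces exponential growth, against the
   polynomial bound [box_card]. *)
have box_grow N : (1 + e) ^+ N <= #|` box N|%:R.
  elim: N => [|N IHN]; first by rewrite expr0 ler1n cardfs_gt0.
  rewrite exprS; apply: le_trans (ler_wpM2l _ IHN) _; first by lra.
  apply: le_trans (ltW (noF _ (box0 N))) _.
  by rewrite ler_nat fsubset_leq_card.
have [N] := expr_dominates_poly #|` T| e0.
rewrite ltNge => /negP; apply; apply: le_trans (box_grow N) _.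
by rewrite -natrX ler_nat.
Qed.

(** * Sums over finite sets, averages and convex combinations *)

Lemma ler_sum_fsubset (R : numDomainType) (I : choiceType) (A B : {fset I})
    (F : I -> R) : (A `<=` B)%fset -> (forall i, 0 <= F i) ->
  \sum_(i <- A) F i <= \sum_(i <- B) F i.
Proof.
move=> AB F0; rewrite [leRHS](big_fsetID _ (mem A))/=.
rewrite (_ : [fset x in B | x \in A]%fset = A); last first.
  by apply/fsetP => x; rewrite !inE/= andbC; apply/andb_idr/(fsubsetP AB).
by rewrite lerDl sumr_ge0.
Qed.

(** Shifting by -t embeds B into C injectively, and the remaining terms over C are nonnegative. *)
Lemma ler_sum_fset_translate (R : numDomainType) (G : zmodType)
    (B C : {fset G}) (t : G) (f : G -> R) :
  (forall b, b \in B -> b - t \in C) -> (forall x, 0 <= f x) ->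
  \sum_(b <- B) f b <= \sum_(x <- C) f (x + t).
Proof.
move=> BC f0.
have -> : \sum_(b <- B) f b = \sum_(x <- [fset b - t | b in B]%fset) f (x + t).
  rewrite big_imfset/=; last by move=> x y _ _ /addIr.
  by apply: eq_bigr => b _; rewrite subrK.
apply: ler_sum_fsubset => //.
by apply/fsubsetP => x /imfsetP[b /= bB ->]; exact: BC.
Qed.

Lemma fset_average_convex_comb (R : realType) (G : zmodType) (f : G -> R)
    (B : {fset G}) : B != fset0 ->
  translates_convex_comb f (fset_average f B).
Proof.
move=> B0; have n0 : (0 < #|` B|)%N by rewrite cardfs_gt0.
exists #|` B|, (fun=> #|` B|%:R^-1), (fun i => nth 0 B i); split=> //.
- by rewrite sumr_const card_ord -[LHS]mulr_natr mulVf// pnatr_eq0 -lt0n.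
- move=> x; rewrite /fset_average -mulr_sumr (big_nth 0) big_mkord.
  by congr (_ * _); apply: eq_bigr => i _; rewrite addrC.
Qed.

Lemma convex_comb_bounded (R : realType) (G : zmodType) (f g : G -> R)
    (a b : R) :
  (forall x, a <= f x <= b) -> translates_convex_comb f g ->
  forall x, a <= g x <= b.
Proof.
move=> fab [n [c [t [_ c0 c1 gE]]]] x; rewrite gE.
rewrite -[a]mul1r -[b]mul1r -c1 !mulr_suml.
by apply/andP; split; apply: ler_sum => i _; rewrite ler_wpM2l//;
  have /andP[] := fab (x + t i).
Qed.

(** * Sumsets and expansion ratios *)

Lemma card_le_sumset (G : zmodType) (B T : {fset G}) :
  T != fset0 -> (#|` B| <= #|` fset_sumset B T|)%N.
Proof.
move=> /fset0Pn[t tT].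
have <- : #|` [fset (b + t)%R | b in B]%fset| = #|` B| :=
  card_imfset _ _ (@addIr G t).
apply: fsubset_leq_card; apply/fsubsetP => x /imfsetP[b /= bB ->].
exact: in_imfset2.
Qed.

Definition expansion_ratio (R : realType) (G : zmodType) (f : G -> R)
    (T B : {fset G}) : R :=
  (#|` fset_sumset B T|%:R)^-1 * \sum_(b <- B) f b.

Lemma expansion_ratio_ge0 (R : realType) (G : zmodType) (f : G -> R)
    (T B : {fset G}) : (forall x, 0 <= f x) -> 0 <= expansion_ratio f T B.
Proof. by move=> f0; rewrite mulr_ge0 ?invr_ge0 ?ler0n ?sumr_ge0. Qed.

Lemma expansion_ratio_leP (R : realType) (G : zmodType) (f : G -> R)
    (T B : {fset G}) (s : R) : T != fset0 -> B != fset0 ->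
  (expansion_ratio f T B <= s) =
  (\sum_(b <- B) f b <= s * #|` fset_sumset B T|%:R).
Proof.
move=> T0 B0; rewrite /expansion_ratio mulrC ler_pdivrMr// ltr0n.
by rewrite (leq_trans _ (card_le_sumset _ T0))// cardfs_gt0.
Qed.

Lemma expansion_ratio_bounded (R : realType) (G : zmodType) (f : G -> R)
    (T B : {fset G}) (M : R) : T != fset0 -> B != fset0 -> 0 <= M ->
  (forall x, f x <= M) -> expansion_ratio f T B <= M.
Proof.
move=> T0 B0 M0 fM; rewrite expansion_ratio_leP//.
apply: (@le_trans _ _ (\sum_(b <- B) M)); first exact: ler_sum.
rewrite big_const_seq count_predT iter_addr_0 -[leLHS]mulr_natr ler_wpM2l//.
by rewrite ler_nat card_le_sumset.
Qed.

(* Average the bound g <= s over C = B - {t_i}: each B - t_i lies in C, so the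
   sum of g over C dominates that of f over B. *)
Lemma expansion_ratio_le_convex_comb (R : realType) (G : zmodType)
    (f g : G -> R) (s : R) : (forall x, 0 <= f x) ->
  translates_convex_comb f g -> (forall x, g x <= s) ->
  exists2 T : {fset G}, T != fset0 &
    forall B : {fset G}, B != fset0 -> expansion_ratio f T B <= s.
Proof.
move=> f0 [n [c [t [n0 c0 c1 gE]]]] gs.
pose T : {fset G} := [fset - t i | i in [set: 'I_n]%SET]%fset.
have tT i : - t i \in T by apply/imfsetP; exists i; rewrite ?inE.
have T0 : T != fset0 by apply/fset0Pn; exists (- t (Ordinal n0)).
exists T => // B B0; rewrite expansion_ratio_leP//.
set C := fset_sumset B T.
apply: (@le_trans _ _ (\sum_(x <- C) g x)); last first.
  apply: (@le_trans _ _ (\sum_(x <- C) s)); first exact: ler_sum.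
  by rewrite big_const_seq count_predT iter_addr_0 mulr_natr.
rewrite (eq_bigr _ (fun x _ => gE x)).
(* Since the weights sum to 1, it suffices to compare the sum over B with each translate's sum over
   C separately. *)
rewrite exchange_big/= -[leLHS]mul1r -c1 mulr_suml; apply: ler_sum => i _.
rewrite -mulr_sumr ler_wpM2l//; apply: ler_sum_fset_translate => // b bB.
exact: in_imfset2.
Qed.

(** The average at x is the sum of f over F + x divided by |F|; the ratio bound for B = F + x makes
    that sum at most s |F + T|, hence at most s d |F|. *)
Lemma fset_average_le_expansion (R : realType) (G : zmodType) (f : G -> R)
    (T F : {fset G}) (s d t : R) (x : G) : T != fset0 -> F != fset0 ->
  0 <= s ->
  (forall B : {fset G}, B != fset0 -> expansion_ratio f T B <= s) ->
  #|` fset_sumset F T|%:R <= d * #|` F|%:R ->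
  fset_average f F x <= s * d.
Proof.
move=> T0 F0 s0 sB Fd; pose B : {fset G} := [fset (b + x)%R | b in F]%fset.
have B0 : B != fset0.
  by case/fset0Pn: F0 => b bF; apply/fset0Pn; exists (b + x); apply: in_imfset.
have := sB B B0; rewrite expansion_ratio_leP//.
rewrite big_imfset/=; last by move=> y z _ _ /addIr.
(* By commutativity (F + x) + T = (F + T) + x, a translate of F + T. *)
have -> : #|` fset_sumset B T| = #|` fset_sumset F T|.
  have <- : #|` [fset (y + x)%R | y in fset_sumset F T]%fset|
      = #|` fset_sumset F T| := card_imfset _ _ (@addIr G x).
  congr (#|` _|); apply/fsetP => y; apply/imfset2P/imfsetP => /=.
    move=> [_ /imfsetP[b /= bF ->] [u uT ->]].
    exists (b + u); last by rewrite addrAC.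
    exact: in_imfset2.
  move=> [_ /imfset2P[b bF [u uT ->]] ->].
  exists (b + x); first exact: in_imfset.
  by exists u => //; rewrite addrAC.
move=> le_sum; rewrite /fset_average mulrC ler_pdivrMr ?ltr0n ?cardfs_gt0//.
by apply: (le_trans le_sum); rewrite -mulrA ler_wpM2l.
Qed.

Theorem theorem6p3 (R : realType) (G : zmodType) (f : G -> R)
    (G_infinite : infinite_set [set: G])
    (f_bounded : bounded_fun f)
    (f_ge0 : forall x : G, 0 <= f x) :
  uppermost_mean f = expansion_pseudomean f /\
  expansion_pseudomean f =
    inf [set sup (range (fset_average f B))
        | B in [set B : {fset G} | B != fset0]].
Proof.
have [M fM] : exists M, forall x, f x <= M.
  have [M fM] := bounded_fun_has_ubound f_bounded.
  by exists M => x; apply: fM; exists x.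
have M0 : 0 <= M := le_trans (f_ge0 0) (fM 0).
have f0M x : 0 <= f x <= M by rewrite f_ge0 fM.
have g0M g : translates_convex_comb f g -> forall x, 0 <= g x <= M.
  exact: convex_comb_bounded.
have g_ub g : translates_convex_comb f g -> has_ubound (range g).
  by move=> /g0M gM; exists M => _ [x _ <-]; have /andP[] := gM x.
have g_sup g : translates_convex_comb f g -> forall x, g x <= sup (range g).
  by move=> /g_ub ubg x; apply: ub_le_sup => //; exists x.
have g_sup0 g : translates_convex_comb f g -> 0 <= sup (range g).
  by move=> fg; apply: le_trans (g_sup g fg 0); have /andP[] := g0M g fg 0.
pose ratios T :=
  [set expansion_ratio f T B | B in [set B : {fset G} | B != fset0]].
(* Together with [ratios0], this makes the inner suprema of E genuine rather than default values. *)
have ratios_ub T : T != fset0 -> has_ubound (ratios T).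
  by move=> T0; exists M => _ [B B0 <-]; exact: expansion_ratio_bounded.
have fset10 : [fset 0 : G]%fset != fset0.
  by apply/fset0Pn; exists 0; rewrite inE.
have ratios0 T : ratios T !=set0.
  by exists (expansion_ratio f T [fset 0]%fset); exists [fset 0]%fset.
have ratios_sup T B : T != fset0 -> B != fset0 ->
    expansion_ratio f T B <= sup (ratios T).
  by move=> T0 B0; apply: ub_le_sup; [exact: ratios_ub|exists B].
have ratios_sup0 T : T != fset0 -> 0 <= sup (ratios T).
  move=> T0; apply: le_trans (ratios_sup T _ T0 fset10).
  exact: expansion_ratio_ge0.
pose A := inf [set sup (range (fset_average f B))
              | B in [set B : {fset G} | B != fset0]].
have EM : expansion_pseudomean f <= uppermost_mean f.
  apply: inf_le_approx.
  - by exists 0 => _ [T T0 <-]; exact: ratios_sup0.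
  - exists (sup (range (fset_average f [fset 0]%fset))).
    exists (fset_average f [fset 0]%fset) => //.
    exact: fset_average_convex_comb.
  - move=> _ [g fg <-] e e0.
    have [T T0 Ts] := expansion_ratio_le_convex_comb f_ge0 fg (g_sup g fg).
    exists (sup (ratios T)); first by exists T.
    apply: (@le_trans _ _ (sup (range g))); last by rewrite lerDl ltW.
    by apply: ge_sup => // _ [B B0 <-]; exact: Ts.
have MA : uppermost_mean f <= A.
  apply: inf_le_approx.
  - by exists 0 => _ [g fg <-]; exact: g_sup0.
  - by exists (sup (range (fset_average f [fset 0]%fset))), [fset 0]%fset.
  - move=> _ [B B0 <-] e e0.
    exists (sup (range (fset_average f B))); last by rewrite lerDl ltW.
    by exists (fset_average f B) => //; exact: fset_average_convex_comb.
have AE : A <= expansion_pseudomean f.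
  apply: inf_le_approx.
  - by exists 0 => _ [B B0 <-]; exact/g_sup0/fset_average_convex_comb.
  - by exists (sup (ratios [fset 0]%fset)), [fset 0]%fset.
  - move=> _ [T T0 <-] e e0; rewrite -/(ratios T); set s := sup (ratios T).
    have s0 : 0 <= s by exact: ratios_sup0.
    (* This tolerance makes the final error s e / (s + 1) at most e; the + 1 covers s = 0. *)
    have d0 : 0 < e / (s + 1) by rewrite divr_gt0// ltr_wpDl.
    have [F F0 FT] := exists_folner_set T d0.
    exists (sup (range (fset_average f F))); first by exists F.
    apply: ge_sup => [|_ [x _ <-]]; first by exists (fset_average f F 0), 0.
    apply: (@le_trans _ _ (s * (1 + e / (s + 1)))).
      by apply: fset_average_le_expansion FT => // B; exact: ratios_sup.
    rewrite mulrDr mulr1 lerD2l mulrA ler_pdivrMr ?ltr_wpDl//.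
    by rewrite mulrC ler_wpM2l ?(ltW e0)// lerDl.
by split; apply/eqP; rewrite eq_le; apply/andP; split=> //;
  [exact: le_trans MA AE|exact: le_trans EM MA].
Qed.
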